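(* For $k\in\mathcal K$ and $1\le j<k$ put $c_j=\bar\Theta_j-j\,\bar\lambda_j=\sum_{r<j}(\bar\lambda_r-\bar\lambda_j)$. Let $\mathcal M_k^{\mathrm{Carla}}$ be the program: minimize $k\,z_k+\sum_{(a,t)\in\mathcal A_T}u^{(k)}_{a,t}$ over $P\in\mathcal F$, $z_k$, $u=(u^{(j)}_{a,t})$ subject to (1) $u^{(j)}_{a,t}\ge\lambda(a,t;P)-\bar\lambda_j$ for all $(a,t)\in\mathcal A_T$, $1\le j<k$; (2) $\sum_{(a,t)\in\mathcal A_T}u^{(j)}_{a,t}\le c_j$ for $1\le j<k$; (3) $u^{(k)}_{a,t}\ge\lambda(a,t;P)-z_k$ for all $(a,t)\in\mathcal A_T$; (4) $0\le u^{(j)}_{a,t}\le\bar\lambda_1-\bar\lambda_j$ for all $(a,t)\in\mathcal A_T$, $1\le j<k$; (5) $0\le z_k\le\bar\lambda_{k-1}$ and $u^{(k)}_{a,t}\ge0$ for all $(a,t)\in\mathcal A_T$, with the convention $\bar\lambda_0=+\infty$. Then for every $k\in\mathcal K$ the optimal value of $\mathcal M_k^{\mathrm{Carla}}$ is $\bar\Theta_k$, and the routing scheme $P_k^\star$ read from any optimal solution satisfies $P_k^\star\in\mathcal F_k$.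
   Context: Setting ($T$-ASR instance). $G=(V,A)$ is a finite directed graph with arc weights $\omega:A\to\mathbb Q_{>0}$ and capacities $c:A\to\mathbb Q_{>0}$ (not to be confused with the constants $c_j$). $T=\{0,\dots,h-1\}$ with $h\ge1$, $T^*=T\setminus\{0\}$. $q:T\to2^A$ with $q(0)=\varnothing$ gives the unavailable arcs, $G_t=(V,A\setminus q(t))$. $\mathcal A_T=\{(a,t):t\in T,\ a\in A\setminus q(t)\}$, $N=|\mathcal A_T|$, $\mathcal K=\{1,\dots,N\}$. $D$ is a finite set of demands; demand $d$ has source $s_d\in V$ and target $t_d\in V$. $\nu:D\times T\to\mathbb Q_{\ge0}$ are traffic volumes, $\kappa:T^*\to\mathbb N$ reconfiguration budgets, $\mathrm{maxSeg}\ge2$ an integer. Split coefficients: the forwarding graph from $u$ to $v$ at time $t$ consists of the arcs of $G_t$ lying on $\omega$-shortest $u$–$v$ paths in $G_t$. $r(u,v,a,t)\ge0$ is the fraction of a unit flow from $u$ to $v$ that uses arc $a$ when the flow entering each vertex is split equally among its outgoing arcs in this forwarding graph; $r(u,v,a,t)=0$ if $a$ is not in it. Segment paths: a segment valid at $t$ is a pair $(i,j)$, $i\ne j$, with $j$ reachable from $i$ in $G_t$. A segment path of $d$ at $t$ is a node sequence $\langle s_d=v_0,v_1,\dots,v_m=t_d\rangle$, $1\le m\le\mathrm{maxSeg}$, whose segments $(v_{l-1},v_l)$ are valid at $t$ and pairwise distinct (nodes may repeat). $\delta(p,ij)=1$ if $p$ contains segment $(i,j)$, else $0$. $\operatorname{dist}(p,p')=\sum_{i\ne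 j}|\delta(p,ij)-\delta(p',ij)|$. $\mathcal F$ is the set of routing schemes $P=(p_d^t)_{d\in D,t\in T}$ ($p_d^t$ a segment path of $d$ at $t$) with $\sum_{d\in D}\operatorname{dist}(p_d^{t-1},p_d^{t})\le\kappa(t)$ for all $t\in T^*$; $\mathcal F$ is assumed non-empty (it is finite). Loads: $\lambda(a,t;P)=\frac1{c(a)}\sum_{d\in D}\sum_{i,j}r(i,j,a,t)\,\nu(d,t)\,\delta(p_d^t,ij)$ for $(a,t)\in\mathcal A_T$; $\lambda^{\downarrow}(P)=(\lambda^{\downarrow}_1(P)\ge\dots\ge\lambda^{\downarrow}_N(P))$ is the load vector sorted in non-increasing order. Recursion: $\mathcal F_0=\mathcal F$ and, for $k\ge1$, $\bar\lambda_k=\min_{P\in\mathcal F_{k-1}}\lambda^{\downarrow}_k(P)$, $\mathcal F_k=\{P\in\mathcal F_{k-1}:\lambda^{\downarrow}_k(P)=\bar\lambda_k\}$. Cumulative outcomes: $\Theta_k(P)=\sum_{r\le k}\lambda^{\downarrow}_r(P)$, $\Theta_0=0$. Let $\mathcal G_0=\mathcal F$, $\bar\Theta_k=\min_{P\in\mathcal G_{k-1}}\Theta_k(P)$, $\mathcal G_k=\{P\in\mathcal G_{k-1}:\Theta_k(P)=\bar\Theta_k\}$ for $k\ge1$. *)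

(* Defs.v *)
From HB Require Import structures.
From mathcomp Require Import all_boot all_order all_algebra.
From mathcomp Require Import boolp.

Set Implicit Arguments.
Unset Strict Implicit.
Unset Printing Implicit Defensive.

Import Order.TTheory GRing.Theory Num.Theory.
Local Open Scope ring_scope.

(* [darc] is an arbitrary finite type with end points, so parallel arcs and
   loops are allowed.  The value of [budget] at time 0 is never used. *)
Record asr_instance := AsrInstance {
  node : finType;
  darc : finType;
  src : darc -> node;
  dst : darc -> node;
  weight : darc -> rat;
  weight_gt0 : forall a, 0 < weight a;
  capacity : darc -> rat;
  capacity_gt0 : forall a, 0 < capacity a;
  horizon : nat;
  horizon_gt0 : (0 < horizon)%N;
  unavail : 'I_horizon -> {set darc};
  unavail0 : forall t : 'I_horizon, t = 0 :> nat -> unavail t = set0;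
  demand : finType;
  dsrc : demand -> node;
  ddst : demand -> node;
  volume : demand -> 'I_horizon -> rat;
  volume_ge0 : forall d t, 0 <= volume d t;
  budget : 'I_horizon -> nat;
  maxseg : nat;
  maxseg_ge2 : (2 <= maxseg)%N
}.

Notation time I := 'I_(horizon I).

Fixpoint walk (I : asr_instance) (t : time I) (x : node I) (s : seq (darc I))
    (y : node I) : bool :=
  if s is a :: s' then
    [&& a \notin unavail t, src a == x & walk t (dst a) s' y]
  else x == y.

Definition walk_weight (I : asr_instance) (s : seq (darc I)) : rat :=
  \sum_(a <- s) weight a.

(* Since the weights are positive, minimising over walks or over simple paths
   gives the same shortest paths. *)
Definition shortest (I : asr_instance) (t : time I) (x : node I)
    (s : seq (darc I)) (y : node I) : Prop :=
  walk t x s y /\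
  forall s', walk t x s' y -> walk_weight s <= walk_weight s'.

Definition forwarding (I : asr_instance) (u v : node I) (t : time I) :
    {set darc I} :=
  [set a | `[< exists2 s, shortest t u s v & a \in s >]].

Definition outdeg (I : asr_instance) (u v : node I) (t : time I)
    (x : node I) : nat :=
  #|[set a in forwarding u v t | src a == x]|.

(* Flow entering [x] when one unit is injected at [u] and the flow entering
   each vertex is split equally among its outgoing forwarding arcs, following
   the forwarding graph back over at most [n] arcs.  The forwarding graph is
   acyclic, so [n = #|node I|] unfoldings give the whole flow; see
   [inflow_balance]. *)
Fixpoint inflow (I : asr_instance) (u v : node I) (t : time I) (n : nat)
    (x : node I) : rat :=
  (x == u)%:R +
  if n is n'.+1 then
    \sum_(a in forwarding u v t | dst a == x)
      inflow u v t n' (src a) / (outdeg u v t (src a))%:R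
  else 0.

Definition split_coef (I : asr_instance) (u v : node I) (a : darc I)
    (t : time I) : rat :=
  if a \in forwarding u v t then
    inflow u v t #|node I| (src a) / (outdeg u v t (src a))%:R
  else 0.

Lemma forwarding_rank (I : asr_instance) (u v : node I) (t : time I) :
  exists2 f : node I -> nat, (forall x, f x < #|node I|)%N &
    forall a, a \in forwarding u v t -> (f (src a) < f (dst a))%N.
Proof.
pose S w := [set x | `[< exists s s', [/\ shortest t x s v, shortest t w s' v &
  walk_weight s' < walk_weight s] >]].
have Sirr w : w \notin S w.
  rewrite inE; apply/asboolPn => -[s [s' [[_ ms] [ws' _]]]].
  by rewrite ltNge ms.
exists (fun w => #|S w|) => [w|a].
  by apply: proper_card; apply/properP; split; [exact/subsetP|exists w].
rewrite inE => /asboolP[s [ws ms] /splitPr as_].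
case: as_ ws ms => s1 s2 ws ms.
have wcat x s3 s4 y : walk t x (s3 ++ s4) y =
    [exists z, walk t x s3 z && walk t z s4 y].
  elim: s3 x => [|b s3 IH] x /=.
    apply/idP/existsP => [w4|[z /andP[/eqP-> //]]].
    by exists x; rewrite eqxx.
  rewrite IH; apply/and3P/existsP => [[-> -> /existsP[z zP]]|[z]].
    by exists z.
  by move=> /andP[/and3P[-> -> w3] w4]; split => //; apply/existsP; exists z;
    rewrite w3.
have wsum s3 s4 : walk_weight (s3 ++ s4) =
    walk_weight s3 + walk_weight s4 :> rat by rewrite /walk_weight big_cat.
have wcons b s3 : walk_weight (b :: s3) = weight b + walk_weight s3 :> rat.
  by rewrite /walk_weight big_cons.
move: ws; rewrite wcat => /existsP[z /andP[w1 /= /and3P[aq /eqP az w2]]].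
have sh_src : shortest t (src a) (a :: s2) v.
  split=> [|s' w']; first by rewrite /= aq eqxx.
  have := ms (s1 ++ s'); rewrite !wsum lerD2l; apply.
  by rewrite wcat; apply/existsP; exists z; rewrite w1 -az.
have sh_dst : shortest t (dst a) s2 v.
  split=> // s' w'; have := sh_src.2 (a :: s'); rewrite !wcons lerD2l; apply.
  by rewrite /= aq eqxx.
apply: proper_card; apply/properP; split; last first.
  exists (src a) => //; rewrite inE; apply/asboolP.
  by exists (a :: s2), s2; split=> //; rewrite wcons ltrDr weight_gt0.
apply/subsetP => x; rewrite !inE => /asboolP[s3 [s' [sh_x sh' lt]]].
apply/asboolP; exists s3, s2; split=> //; apply: le_lt_trans lt.
apply: le_trans (sh_src.2 _ sh'.1); rewrite wcons lerDr ltW //.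
exact: weight_gt0.
Qed.

Lemma inflow_balance (I : asr_instance) (u v : node I) (t : time I)
    (x : node I) :
  inflow u v t #|node I| x =
    (x == u)%:R +
    \sum_(a in forwarding u v t | dst a == x) split_coef u v a t.
Proof.
have [f f_lt f_fwd] := forwarding_rank u v t.
have stable : forall m n y, (f y < m)%N -> (f y < n)%N ->
    inflow u v t m y = inflow u v t n y.
  elim=> [//|m IH] [//|n] y lt_m lt_n /=; congr (_ + _).
  apply: eq_bigr => a /andP[/f_fwd lt_a /eqP ay].
  by rewrite ay in lt_a; rewrite (IH n) // (leq_trans lt_a).
rewrite (stable _ #|node I|.+1 x) // ?(leq_trans (f_lt x)) //=.
by congr (_ + _); apply: eq_bigr => a /andP[aF _]; rewrite /split_coef aF.
Qed.

Definition reachable (I : asr_instance) (t : time I) : rel (node I) :=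
  connect (fun x y =>
    [exists a, [&& a \notin unavail t, src a == x & dst a == y]]).

Definition valid_segment (I : asr_instance) (t : time I)
    (ij : node I * node I) : bool :=
  (ij.1 != ij.2) && reachable t ij.1 ij.2.

Definition segments (V : Type) (p : seq V) : seq (V * V) := zip p (behead p).

(* The node sequence v_0, ..., v_m is stored as a list of size m + 1; the bound
   m <= maxseg is part of the type. *)
Notation node_seq I := ((maxseg I).+1.-bseq (node I)).

Definition segment_path (I : asr_instance) (d : demand I) (t : time I)
    (p : node_seq I) : bool :=
  [&& (1 < size p)%N,
      head (dsrc d) p == dsrc d,
      last (dsrc d) p == ddst d,
      all (valid_segment t) (segments p) &
      uniq (segments p)].

Definition has_segment (I : asr_instance) (p : node_seq I)
    (ij : node I * node I) : nat :=
  ij \in segments p.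

Definition path_dist (I : asr_instance) (p p' : node_seq I) : nat :=
  (\sum_(ij : node I * node I | ij.1 != ij.2)
     `|(has_segment p ij)%:Z - (has_segment p' ij)%:Z|)%N.

Notation scheme I := {ffun demand I -> {ffun time I -> node_seq I}}.

Definition routing_schemes (I : asr_instance) : {set scheme I} :=
  [set P : scheme I |
    [forall d, forall t, segment_path d t (P d t)] &&
    [forall t : time I, forall t' : time I,
      (t' == t.+1 :> nat) ==>
      (\sum_d path_dist (P d t) (P d t') <= budget t')%N]].

Definition avail_arcs (I : asr_instance) : {set darc I * time I} :=
  [set at_ | at_.1 \notin unavail at_.2].

Definition load (I : asr_instance) (P : scheme I) (at_ : darc I * time I) : rat :=
  (capacity at_.1)^-1 *
  \sum_(d : demand I) \sum_(ij : node I * node I)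
     split_coef ij.1 ij.2 at_.1 at_.2 * volume d at_.2 *
     (has_segment (P d at_.2) ij)%:R.

(* The [k]-th largest load, counting from 1. *)
Definition sorted_load (I : asr_instance) (k : nat) (P : scheme I) : rat :=
  nth 0 (sort >=%R [seq load P at_ | at_ <- enum (avail_arcs I)]) k.-1.

Definition cum_load (I : asr_instance) (k : nat) (P : scheme I) : rat :=
  \sum_(1 <= r < k.+1) sorted_load r P.

(* The minimum of [f] over [S] (0 if [S] is empty). *)
Definition min_over (X : finType) (S : {set X}) (f : X -> rat) : rat :=
  if [pick x in S] is Some x0 then \big[Order.min/f x0]_(x in S) f x else 0.

Fixpoint lex_minimizers (X : finType) (S : {set X}) (f : nat -> X -> rat)
    (k : nat) : {set X} :=
  if k is k'.+1 then
    let S' := lex_minimizers S f k' in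
    [set x in S' | f k x == min_over S' (f k)]
  else S.

(* Meaningful for [k >= 1] only. *)
Definition lex_value (X : finType) (S : {set X}) (f : nat -> X -> rat)
    (k : nat) : rat :=
  min_over (lex_minimizers S f k.-1) (f k).

Definition load_optimal (I : asr_instance) (k : nat) : {set scheme I} :=
  lex_minimizers (routing_schemes I) (@sorted_load I) k.

Definition opt_load (I : asr_instance) (k : nat) : rat :=
  lex_value (routing_schemes I) (@sorted_load I) k.

Definition opt_cum (I : asr_instance) (k : nat) : rat :=
  lex_value (routing_schemes I) (@cum_load I) k.

Definition carla_cst (I : asr_instance) (j : nat) : rat :=
  opt_cum I j - j%:R * opt_load I j.

(* The data are rational; the continuous variables [z] and [u j] of the program
   range over [R].  Only [u j] for [1 <= j <= k] and arguments in [avail_arcs]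
   occur in the program. *)
Record carla_solution (I : asr_instance) (R : realFieldType) := CarlaSolution {
  routing : scheme I;
  zvar : R;
  uvar : nat -> darc I * time I -> R
}.

Definition carla_feasible (I : asr_instance) (R : realFieldType) (k : nat)
    (x : carla_solution I R) : Prop :=
  [/\ routing x \in routing_schemes I,
      forall j, (1 <= j < k)%N ->
        [/\ forall at_, at_ \in avail_arcs I ->
              ratr (load (routing x) at_ - opt_load I j) <= uvar x j at_,
            \sum_(at_ in avail_arcs I) uvar x j at_ <= ratr (carla_cst I j) &
            forall at_, at_ \in avail_arcs I ->
              0 <= uvar x j at_ <= ratr (opt_load I 1 - opt_load I j)],
      forall at_, at_ \in avail_arcs I ->
        ratr (load (routing x) at_) - zvar x <= uvar x k at_,
      (* no upper bound on z for k = 1, the 0-th optimal load being +oo *)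
      0 <= zvar x /\ ((1 < k)%N -> zvar x <= ratr (opt_load I k.-1)) &
      forall at_, at_ \in avail_arcs I -> 0 <= uvar x k at_].

Definition carla_objective (I : asr_instance) (R : realFieldType) (k : nat)
    (x : carla_solution I R) : R :=
  k%:R * zvar x + \sum_(at_ in avail_arcs I) uvar x k at_.

Definition carla_optimal (I : asr_instance) (R : realFieldType) (k : nat)
    (x : carla_solution I R) : Prop :=
  carla_feasible k x /\
  forall y : carla_solution I R, carla_feasible k y ->
    carla_objective k x <= carla_objective k y.

Definition carla_optimal_value (I : asr_instance) (R : realFieldType) (k : nat)
    (val : R) : Prop :=
  exists2 x : carla_solution I R,
    carla_optimal k x & carla_objective k x = val.

(* Main.v *)
(* For every [z], the sum of the [k] largest entries of a vector is at most [k z]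
   plus the sum of the excesses [max 0 (x - z)], with equality when [z] is the
   [k]-th largest entry.  Hence the constraints (1), (2), (4) for [j] bound the
   [j]-th cumulative load of the scheme by its lexicographic optimum, which by
   induction on [j < k] puts the scheme among the lexicographic minimizers of
   order [k-1]; there the objective dominates the [k]-th cumulative load.
   Conversely a lexicographic minimizer of order [k], with the optimal loads as
   thresholds and the excesses as [u], is feasible and attains the bound. *)
Require Import Defs.
From HB Require Import structures.
From mathcomp Require Import all_boot all_order all_algebra.
From mathcomp Require Import ring.

Set Implicit Arguments.
Unset Strict Implicit.
Unset Printing Implicit Defensive.

Import Order.TTheory GRing.Theory Num.Theory.
Local Open Scope ring_scope.

(** * Minima over finite sets and lexicographic minimizers *)

Lemma min_over_le (X : finType) (S : {set X}) (f : X -> rat) (x : X) :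
  x \in S -> min_over S f <= f x.
Proof.
rewrite /min_over; case: pickP => [x0 _ xS|S0]; last by rewrite S0.
exact: bigmin_le_cond.
Qed.

Lemma min_over_attained (X : finType) (S : {set X}) (f : X -> rat) :
  S != set0 -> exists2 x, x \in S & f x = min_over S f.
Proof.
case/set0Pn=> y yS; rewrite /min_over; case: pickP => [x0 x0S|S0]; last first.
  by rewrite S0 in yS.
apply: (big_ind (fun v => exists2 x, x \in S & f x = v)) => [|v w|x xS].
- by exists x0.
- by move=> [x xS <-] [z zS <-]; rewrite /Order.min; case: ifP; [exists x|exists z].
- by exists x.
Qed.

Lemma min_over_shift (X : finType) (S : {set X}) (f g : X -> rat) (c : rat) :
  S != set0 -> {in S, forall x, g x = c + f x} ->
  min_over S g = c + min_over S f.
Proof.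
move=> S0 gE; apply/le_anti/andP; split.
  have [x xS <-] := min_over_attained f S0.
  by rewrite -gE // min_over_le.
have [x xS <-] := min_over_attained g S0.
by rewrite gE // lerD2l min_over_le.
Qed.

Lemma lex_minimizers_neq0 (X : finType) (S : {set X}) (f : nat -> X -> rat) k :
  S != set0 -> lex_minimizers S f k != set0.
Proof.
move=> S0; elim: k => //= k IH.
have [x xS fx] := min_over_attained (f k.+1) IH.
by apply/set0Pn; exists x; rewrite inE xS fx eqxx.
Qed.

Lemma lex_minimizers_sub (X : finType) (S : {set X}) (f : nat -> X -> rat) k :
  lex_minimizers S f k \subset S.
Proof.
elim: k => //= k IH; apply: subset_trans IH.
by apply/subsetP => x; rewrite inE => /andP[].
Qed.

Lemma lex_minimizers_value (X : finType) (S : {set X}) (f : nat -> X -> rat)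
    k x r :
  x \in lex_minimizers S f k -> (1 <= r <= k)%N -> f r x = lex_value S f r.
Proof.
elim: k => [|k IH] /=; first by case: r.
rewrite inE => /andP[xS /eqP fx] /andP[r1].
rewrite leq_eqVlt => /predU1P[->|rk]; first exact: fx.
by apply: IH => //; rewrite r1.
Qed.

(** The first [k] values of [f] are constant on the minimizers of order [k], so there [g k.+1] is
    [f k.+1] plus a constant and selects the same points. *)
Lemma lex_minimizers_cumul (X : finType) (S : {set X}) (f g : nat -> X -> rat) :
  S != set0 -> (forall k x, g k x = \sum_(1 <= r < k.+1) f r x) ->
  forall k, lex_minimizers S g k = lex_minimizers S f k.
Proof.
move=> S0 gE; elim=> //= k ->.
have gS : {in lex_minimizers S f k, forall x,
    g k.+1 x = \sum_(1 <= r < k.+1) lex_value S f r + f k.+1 x}.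
  move=> x xS; rewrite gE big_nat_recr //=; congr (_ + _).
  by apply: eq_big_nat => r rk; apply: lex_minimizers_value xS _.
rewrite (min_over_shift (lex_minimizers_neq0 f k S0) gS).
apply/setP => x; rewrite !inE; case xS : (x \in _) => //=.
by rewrite gS // (inj_eq (addrI _)).
Qed.

Lemma lex_value_cumul (X : finType) (S : {set X}) (f g : nat -> X -> rat) k :
  S != set0 -> (forall k x, g k x = \sum_(1 <= r < k.+1) f r x) -> (0 < k)%N ->
  lex_value S g k = \sum_(1 <= r < k.+1) lex_value S f r.
Proof.
move=> S0 gE k0; have /set0Pn[x xS] := lex_minimizers_neq0 f k S0.
have xS' : x \in lex_minimizers S g k by rewrite (lex_minimizers_cumul S0 gE).
rewrite -(lex_minimizers_value xS') ?k0 ?leqnn // gE.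
by apply: eq_big_nat => r rk; apply: lex_minimizers_value xS _.
Qed.

(** * Sums of leading entries and excesses over a threshold *)

Lemma sum_nth_le_excess (R : realFieldType) (T : Type) (x0 : T) (s : seq T)
    (f : T -> R) (z : R) k :
  (k <= size s)%N ->
  \sum_(0 <= i < k) f (nth x0 s i) <=
    k%:R * z + \sum_(x <- s) Num.max 0 (f x - z).
Proof.
move=> ks; rewrite (big_nth x0) (big_cat_nat (leq0n _) ks) //=.
have -> : k%:R * z = \sum_(0 <= i < k) z.
  by rewrite big_const_nat subn0 iter_addr_0 mulr_natl.
(* Termwise on the first [k] entries, [f x <= z + max 0 (f x - z)]; the excesses of the other
   entries only add to the right side. *)
rewrite addrA -big_split /= -[leLHS]addr0; apply: lerD.
  by apply: ler_sum => i _; rewrite -lerBlDl le_max lexx orbT.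
by apply: sumr_ge0 => i _; rewrite le_max lexx.
Qed.

Lemma sorted_ge_nth (R : realFieldType) (s : seq R) i j :
  sorted >=%R s -> (i <= j)%N -> (j < size s)%N -> s`_j <= s`_i.
Proof.
move=> s_sorted ij js.
apply: (sorted_leq_nth (leT := >=%R) ge_trans lexx 0 s_sorted) => //.
by rewrite inE (leq_ltn_trans ij).
Qed.

(** Entries after position [k] have no excess over the entry there, and earlier ones have their full
    difference as excess. Positions count from 0, hence the [k.+1]. *)
Lemma sum_nth_eq_excess (R : realFieldType) (s : seq R) k :
  sorted >=%R s -> (k < size s)%N ->
  k.+1%:R * s`_k + \sum_(x <- s) Num.max 0 (x - s`_k) =
    \sum_(0 <= i < k.+1) s`_i.
Proof.
move=> s_sorted ks; rewrite (big_nth 0) (big_cat_nat (leq0n _) ks) //=.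
have s_le i j := @sorted_ge_nth R s i j s_sorted.
rewrite [X in _ + (_ + X)]big1_seq ?addr0; last first.
  move=> i; rewrite mem_index_iota => /= /andP[ki is_].
  by apply/max_idPl; rewrite subr_le0 s_le // ltnW.
have -> : k.+1%:R * s`_k = \sum_(0 <= i < k.+1) s`_k.
  by rewrite big_const_nat subn0 iter_addr_0 mulr_natl.
rewrite -big_split /=; apply: eq_big_nat => i /andP[_ ik].
by rewrite (max_idPr _) ?subr_ge0 ?s_le // addrC subrK.
Qed.

(** * Loads and their sorted vector *)

Section Loads.

Variable I : asr_instance.
Implicit Types (P : scheme I) (k j : nat).

Lemma inflow_ge0 (u v : node I) (t : time I) n x : 0 <= inflow u v t n x.
Proof.
elim: n x => [|n IH] x /=; first by rewrite addr0.
by rewrite addr_ge0 // sumr_ge0 // => a _; rewrite divr_ge0.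
Qed.

Lemma split_coef_ge0 (u v : node I) a (t : time I) : 0 <= split_coef u v a t.
Proof.
by rewrite /split_coef; case: ifP => // _; rewrite divr_ge0 ?inflow_ge0.
Qed.

Lemma load_ge0 P at_ : 0 <= load P at_.
Proof.
rewrite mulr_ge0 ?invr_ge0 ?(ltW (capacity_gt0 _)) //.
apply: sumr_ge0 => d _; apply: sumr_ge0 => ij _.
by rewrite !mulr_ge0 ?split_coef_ge0 ?volume_ge0.
Qed.

Definition sorted_loads P : seq rat :=
  sort >=%R [seq load P at_ | at_ <- enum (avail_arcs I)].

Lemma size_sorted_loads P : size (sorted_loads P) = #|avail_arcs I|.
Proof. by rewrite size_sort size_map -cardE. Qed.

Lemma sorted_loads_sorted P : sorted >=%R (sorted_loads P).
Proof. exact/sort_sorted/ge_total. Qed.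

Lemma mem_sorted_loads P x :
  (x \in sorted_loads P) = (x \in [seq load P at_ | at_ in avail_arcs I]).
Proof. by rewrite mem_sort. Qed.

Lemma sum_sorted_loads (R : realFieldType) P (f : rat -> R) :
  \sum_(x <- sorted_loads P) f x = \sum_(at_ in avail_arcs I) f (load P at_).
Proof.
by rewrite (perm_big _ (permEl (perm_sort _ _))) big_map big_enum.
Qed.

Lemma sorted_load_ge0 k P : 0 <= sorted_load k P.
Proof.
rewrite /sorted_load -/(sorted_loads P).
(* Past the end of the list, [nth] returns the default 0. *)
have [ks|ks] := ltnP k.-1 (size (sorted_loads P)); last by rewrite nth_default.
by have := mem_nth 0 ks; rewrite mem_sorted_loads => /imageP[at_ _ ->];
  apply: load_ge0.
Qed.

Lemma sorted_load_le j k P :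
  (j <= k <= #|avail_arcs I|)%N -> (0 < k)%N ->
  sorted_load k P <= sorted_load j P.
Proof.
case/andP=> jk kA k0; rewrite /sorted_load -/(sorted_loads P).
have kA' : (k.-1 < #|avail_arcs I|)%N by rewrite prednK.
have jk' : (j.-1 <= k.-1)%N by rewrite -!subn1 leq_sub2r.
by apply: sorted_ge_nth; rewrite ?sorted_loads_sorted ?size_sorted_loads.
Qed.

Lemma load_le_first P at_ : at_ \in avail_arcs I -> load P at_ <= sorted_load 1 P.
Proof.
move=> atA; have : load P at_ \in sorted_loads P.
  by rewrite mem_sorted_loads; apply: image_f.
rewrite /sorted_load -/(sorted_loads P) => /(nthP 0)[i il <-].
by apply: sorted_ge_nth; rewrite ?sorted_loads_sorted.
Qed.

Lemma cum_loadE k P :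
  cum_load k P = \sum_(0 <= i < k) (sorted_loads P)`_i.
Proof. by rewrite /cum_load big_add1. Qed.

(** The hypotheses put [u] above the excesses over [z]. This serves both for [j < k], with [z] the
    [j]-th optimal load, and for the objective, with [z] the variable [zvar]. *)
Lemma cum_load_le (R : realFieldType) k P (z : R) (u : darc I * time I -> R) :
  (k <= #|avail_arcs I|)%N ->
  (forall at_, at_ \in avail_arcs I -> ratr (load P at_) - z <= u at_) ->
  (forall at_, at_ \in avail_arcs I -> 0 <= u at_) ->
  ratr (cum_load k P) <= k%:R * z + \sum_(at_ in avail_arcs I) u at_.
Proof.
move=> kA uge u0; rewrite cum_loadE rmorph_sum /=.
apply: (le_trans (sum_nth_le_excess _ _ z _)).
  by rewrite size_sorted_loads.
rewrite lerD2l (sum_sorted_loads P (fun x => Num.max 0 (ratr x - z))).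
by apply: ler_sum => at_ atA; rewrite ge_max u0 ?uge.
Qed.

(** The equality case; its right side has the shape of [carla_cst], which makes constraint (2) tight
    for a lexicographic minimizer. *)
Lemma sum_excess k P :
  (1 <= k <= #|avail_arcs I|)%N ->
  \sum_(at_ in avail_arcs I) Num.max 0 (load P at_ - sorted_load k P) =
    cum_load k P - k%:R * sorted_load k P.
Proof.
case: k => // k /= kA; rewrite cum_loadE -sum_nth_eq_excess.
- by rewrite (sum_sorted_loads P (fun x => Num.max 0 (x - _))) addrC addKr.
- exact: sorted_loads_sorted.
- by rewrite size_sorted_loads.
Qed.

(** * Cumulative optima against optima of single loads *)

Hypothesis hF : routing_schemes I != set0.

Lemma lex_cum_load k :
  lex_minimizers (routing_schemes I) (@cum_load I) k = load_optimal I k.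
Proof. exact: lex_minimizers_cumul. Qed.

Lemma opt_cumE k : (0 < k)%N -> opt_cum I k = \sum_(1 <= r < k.+1) opt_load I r.
Proof. exact: lex_value_cumul. Qed.

Lemma load_optimal_cum_load k P :
  P \in load_optimal I k.-1 -> opt_cum I k <= cum_load k P.
Proof. by rewrite -lex_cum_load; apply: min_over_le. Qed.

(** Minimizers may be computed with cumulative loads, and within the set of order [k] these cannot
    fall below the optimum; an upper bound thus suffices. *)
Lemma load_optimalS k P :
  P \in load_optimal I k -> cum_load k.+1 P <= opt_cum I k.+1 ->
  P \in load_optimal I k.+1.
Proof.
rewrite -!lex_cum_load /= inE => PG le_cum.
by rewrite PG eq_le le_cum min_over_le.
Qed.

(** * The program: lower bound, attainment, optimal solutions *)

Variable R : realFieldType.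
Implicit Type x : carla_solution I R.

Lemma carla_feasible_load_optimal k x :
  (k <= #|avail_arcs I|)%N -> carla_feasible k x ->
  forall j, (j < k)%N -> routing x \in load_optimal I j.
Proof.
move=> kA [xF xj _ _ _]; elim=> [|j IH] jk; first exact: xF.
apply: load_optimalS; first by apply: IH; apply: ltnW.
have [u_ge u_sum u_bnd] := xj j.+1 jk.
rewrite -(ler_rat R); apply: le_trans (cum_load_le (z := ratr (opt_load I j.+1))
  (u := uvar x j.+1) _ _ _) _.
- by apply: leq_trans kA; apply: ltnW.
- by move=> at_ atA; rewrite -rmorphB u_ge.
- by move=> at_ /u_bnd/andP[].
(* Adding [j.+1] times the threshold to both sides of (2) leaves exactly [opt_cum I j.+1] on the
   right. *)
move: u_sum; rewrite /carla_cst rmorphB rmorphM /= ratr_nat.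
by rewrite lerBrDl.
Qed.

Lemma carla_objective_ge_cum_load k x :
  (k <= #|avail_arcs I|)%N -> carla_feasible k x ->
  ratr (cum_load k (routing x)) <= carla_objective k x.
Proof. by move=> kA [_ _ u_ge _ u0]; apply: cum_load_le. Qed.

Lemma carla_objective_ge k x :
  (1 <= k <= #|avail_arcs I|)%N -> carla_feasible k x ->
  ratr (opt_cum I k) <= carla_objective k x.
Proof.
case/andP=> k0 kA xfeas; apply: le_trans (carla_objective_ge_cum_load kA xfeas).
rewrite ler_rat load_optimal_cum_load //.
by apply: (carla_feasible_load_optimal kA xfeas); rewrite prednK.
Qed.

(** Each [u] takes the least value allowed by nonnegativity and by (1) or (3); one formula covers
    [j < k] and [j = k] because [z] is the [k]-th optimal load. *)
Definition carla_of_scheme P k : carla_solution I R :=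
  CarlaSolution P (ratr (opt_load I k))
    (fun j at_ => ratr (Num.max 0 (load P at_ - opt_load I j))).

Lemma carla_of_scheme_feasible k P :
  (1 <= k <= #|avail_arcs I|)%N -> P \in load_optimal I k ->
  carla_feasible k (carla_of_scheme P k).
Proof.
case/andP=> k0 kA PF.
(* The optimal loads become the sorted loads of [P] itself, so feasibility concerns a single sorted
   vector. *)
have optE j : (1 <= j <= k)%N -> opt_load I j = sorted_load j P.
  by move=> jk; rewrite (lex_minimizers_value PF jk).
split=> /=.
- exact: (subsetP (lex_minimizers_sub _ _ _)) PF.
- move=> j /andP[j0 jk]; split=> [at_ _||at_ atA].
  + by rewrite ler_rat le_max lexx orbT.
  + rewrite -rmorph_sum /= ler_rat /carla_cst opt_cumE //.
    rewrite optE ?j0 1?ltnW // sum_excess ?j0 ?(leq_trans (ltnW jk)) //.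
    rewrite lerD2r le_eqVlt; apply/orP; left; apply/eqP.
    apply: eq_big_nat => r /andP[r0 rj].
    by rewrite optE // r0 (leq_trans _ (ltnW jk)).
  + have jA : (1 <= j <= #|avail_arcs I|)%N by rewrite j0 (leq_trans (ltnW jk)).
    rewrite !(ler_rat, ler0q) le_max lexx /= ge_max !optE ?j0 ?(ltnW jk) //.
    (* The upper half of (4): zero stays below since sorted loads decrease, and a positive excess
       since no load exceeds the first. *)
    by rewrite subr_ge0 sorted_load_le //= lerD2r load_le_first.
- by move=> at_ _; rewrite -rmorphB ler_rat le_max lexx orbT.
- rewrite ler0q optE ?k0 ?leqnn // sorted_load_ge0; split=> // k1.
  rewrite ler_rat optE -?subn1 ?subn_gt0 ?k1 ?leq_subr //.
  by rewrite sorted_load_le ?leq_subr.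
- by move=> at_ _; rewrite ler0q le_max lexx.
Qed.

Lemma carla_of_scheme_objective k P :
  (1 <= k <= #|avail_arcs I|)%N -> P \in load_optimal I k ->
  carla_objective k (carla_of_scheme P k) = ratr (opt_cum I k).
Proof.
move=> kA PF; have /andP[k0 _] := kA.
have PG : P \in lex_minimizers (routing_schemes I) (@cum_load I) k.
  by rewrite lex_cum_load.
rewrite /carla_objective /= -rmorph_sum -ratr_nat -rmorphM -rmorphD /=.
rewrite /opt_load -(lex_minimizers_value PF) ?k0 ?leqnn // sum_excess //.
by rewrite addrC subrK (lex_minimizers_value PG) ?k0 /=.
Qed.

Lemma carla_optimal_value_opt_cum k :
  (1 <= k <= #|avail_arcs I|)%N ->
  carla_optimal_value I k (ratr (opt_cum I k) : R).
Proof.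
move=> kA; have /set0Pn[P PF] := lex_minimizers_neq0 (@sorted_load I) k hF.
exists (carla_of_scheme P k); last exact: carla_of_scheme_objective.
split=> [|y yfeas]; first exact: carla_of_scheme_feasible.
by rewrite carla_of_scheme_objective // carla_objective_ge.
Qed.

(** The [k]-th cumulative load is at most the objective, which by optimality is at most the attained
    value [opt_cum I k]; membership at order [k-1] comes from feasibility. *)
Lemma carla_optimal_load_optimal k x :
  (1 <= k <= #|avail_arcs I|)%N -> carla_optimal k x ->
  routing x \in load_optimal I k.
Proof.
case: k => // k kA [xfeas xmin].
apply: load_optimalS; first exact: (carla_feasible_load_optimal _ xfeas).
rewrite -(ler_rat R).
apply: le_trans (carla_objective_ge_cum_load _ xfeas) _ => //.
by have [y [yfeas _] <-] := carla_optimal_value_opt_cum kA; apply: xmin.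
Qed.

End Loads.

Theorem theorem3 (I : asr_instance) (hF : routing_schemes I != set0)
    (R : realFieldType) (k : nat) (hk : (1 <= k <= #|avail_arcs I|)%N) :
  [/\ forall j, (1 <= j < k)%N ->
        carla_cst I j = \sum_(1 <= r < j) (opt_load I r - opt_load I j),
      carla_optimal_value I k (ratr (opt_cum I k) : R) &
      forall x : carla_solution I R,
        carla_optimal k x -> routing x \in load_optimal I k].
Proof.
split=> [[//|j] _|//|x].
(* The last term of [opt_cum I j.+1] cancels one of the [j.+1] copies of [opt_load I j.+1]; the
   other [j] are spread over the [j] summands. *)
- rewrite /carla_cst opt_cumE // big_nat_recr //= sumrB.
  by rewrite sumr_const_nat subn1 -mulr_natl /= -natr1; ring.
- exact: carla_optimal_value_opt_cum.
- exact: carla_optimal_load_optimal.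
Qed.
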